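(* Let $\mathfrak g$ with ideal $\mathfrak p$ be one of the following: (a) for $\ell\in\frac12\mathbb N$, the conformal Galilei algebra $\mathfrak g^{(\ell)}$ with basis $\{e,h,f,p_k: k=0,1,\dots,2\ell\}$ and nonzero brackets $[h,e]=2e$, $[h,f]=-2f$, $[e,f]=h$, $[h,p_k]=2(\ell-k)p_k$, $[e,p_k]=kp_{k-1}$, $[f,p_k]=(2\ell-k)p_{k+1}$, with $\mathfrak p=\mathrm{Span}\{p_k: 0\le k\le 2\ell\}$; or (b) for $n\in\mathbb N$, the $n$-th Schrödinger algebra $\mathfrak{sch}_n$ with basis $\{h,e,f,x_i,y_i,z: 1\le i\le n\}$ and brackets $[h,e]=2e$, $[h,f]=-2f$, $[e,f]=h$, $[h,x_i]=x_i$, $[e,x_i]=0$, $[f,x_i]=y_i$, $[h,y_i]=-y_i$, $[e,y_i]=x_i$, $[f,y_i]=0$, $[x_i,x_j]=[y_i,y_j]=0$, $[x_i,y_j]=\delta_{ij}z$, $z$ central, with $\mathfrak p=\mathrm{Span}\{x_i,y_i,z:1\le i\le n\}$. Let $\phi:\mathfrak p\to\mathbb C$ be a nonzero Lie algebra homomorphism. Then every irreducible quasi-Whittaker $\mathfrak g$-module of type $\phi$ is bland, i.e., is isomorphic to either $W(\phi)$ or $V(\phi')$ for some Lie algebra homomorphism $\phi':\mathfrak g^\phi\to\mathbb C$ extending $\phi$.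
   Context: A Lie algebra homomorphism to $\mathbb C$ is a linear map vanishing on the derived subalgebra. For a $\mathfrak g$-module $V$, $V_\phi=\{v: pv=\phi(p)v\ \forall p\in\mathfrak p\}$; $V$ is a quasi-Whittaker module of type $\phi$ if it is generated by an element of $V_\phi$; an irreducible such $V$ is bland if $\dim V_\phi=1$. $W(\phi)=\mathcal U(\mathfrak g)\otimes_{\mathcal U(\mathfrak p)}\mathbb C w_\phi$ where $pw_\phi=\phi(p)w_\phi$. $\mathfrak g^{\phi}=\{g\in\mathfrak g:\phi([g,p])=0\ \forall p\in\mathfrak p\}$. For an extension $\phi'$ of $\phi$ to $\mathfrak g^\phi$, $V(\phi')=\mathcal U(\mathfrak g)\otimes_{\mathcal U(\mathfrak g^\phi)}\mathbb C v_{\phi'}$ where $yv_{\phi'}=\phi'(y)v_{\phi'}$. *)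

(* Defs.v *)
From mathcomp Require Import all_boot all_order all_algebra.
From mathcomp.real_closed Require Import complex.
From mathcomp Require Import Rstruct.
Set Implicit Arguments. Unset Strict Implicit. Unset Printing Implicit Defensive.
Import Order.TTheory GRing.Theory Num.Theory.
Local Open Scope ring_scope.

Definition C : numClosedFieldType := complex Rdefinitions.R.

(* Finite-dimensional Lie algebras given by a basis I and structure constants
   br i j k = coefficient of basis vector k in [i, j].
   Elements of g are coordinate vectors x : I -> C.                          *)
Section LieFramework.
Variables (I : finType) (br : I -> I -> I -> C).

Definition bvec (i : I) : I -> C := fun k => (k == i)%:R.

Definition bracket (x y : I -> C) : I -> C :=
  fun k => \sum_i \sum_j x i * y j * br i j k.

Definition is_gmodule (V : lmodType C) (rho : I -> V -> V) : Prop :=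
  (forall i (a : C) (u v : V), rho i (a *: u + v) = a *: rho i u + rho i v) /\
  (forall i j (v : V),
      rho i (rho j v) - rho j (rho i v) = \sum_k br i j k *: rho k v).

Definition act (V : lmodType C) (rho : I -> V -> V) (x : I -> C) (v : V) : V :=
  \sum_i x i *: rho i v.

Definition is_submodule (V : lmodType C) (rho : I -> V -> V) (S : V -> Prop) :=
  [/\ S 0, (forall u v, S u -> S v -> S (u + v)),
      (forall (a : C) v, S v -> S (a *: v)) & (forall i v, S v -> S (rho i v))].

Definition irreducible (V : lmodType C) (rho : I -> V -> V) : Prop :=
  (exists v : V, v <> 0) /\
  forall S, is_submodule rho S -> (forall v, S v -> v = 0) \/ (forall v, S v).

Definition generated_by (V : lmodType C) (rho : I -> V -> V) (v : V) : Prop :=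
  forall S, is_submodule rho S -> S v -> forall w, S w.

Definition is_ghom (V M : lmodType C) (rho : I -> V -> V) (rhoM : I -> M -> M)
    (f : V -> M) : Prop :=
  (forall (a : C) (u v : V), f (a *: u + v) = a *: f u + f v) /\
  (forall i v, f (rho i v) = rhoM i (f v)).

(* V is isomorphic to the induced module U(g) (x)_{U(K)} C_psi, where K is a
   subalgebra of g (given as a predicate on g) and psi : K -> C a character.
   Stated through the defining universal property of the induced module:
   V has a vector v on which K acts by psi, and for every g-module M and every
   m in M on which K acts by psi there is a unique g-module map V -> M
   sending v to m. *)
Definition iso_induced (V : lmodType C) (rho : I -> V -> V)
    (K : (I -> C) -> Prop) (psi : (I -> C) -> C) : Prop :=
  exists v : V,
    (forall x, K x -> act rho x v = psi x *: v) /\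
    forall (M : lmodType C) (rhoM : I -> M -> M), is_gmodule rhoM ->
      forall m : M, (forall x, K x -> act rhoM x m = psi x *: m) ->
        exists! f : V -> M, is_ghom rho rhoM f /\ f v = m.

Variable P : pred I. (* the ideal p = Span {basis vectors i | P i} *)

Definition in_p (x : I -> C) : Prop := forall k, ~~ P k -> x k = 0.

Definition phi_ev (phi : I -> C) (x : I -> C) : C := \sum_(k | P k) x k * phi k.

Definition is_lie_hom_p (phi : I -> C) : Prop :=
  forall x y, in_p x -> in_p y -> phi_ev phi (bracket x y) = 0.

Definition nonzero_p (phi : I -> C) : Prop := exists k, P k /\ phi k <> 0.

Definition in_Vphi (V : lmodType C) (rho : I -> V -> V) (phi : I -> C) (v : V) :=
  forall x, in_p x -> act rho x v = phi_ev phi x *: v.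

Definition quasi_whittaker (V : lmodType C) (rho : I -> V -> V) (phi : I -> C) :=
  exists v, in_Vphi rho phi v /\ generated_by rho v.

Definition bland (V : lmodType C) (rho : I -> V -> V) (phi : I -> C) : Prop :=
  irreducible rho /\
  exists v : V, [/\ v <> 0, in_Vphi rho phi v &
                    forall w, in_Vphi rho phi w -> exists a : C, w = a *: v].

Definition in_gphi (phi : I -> C) (x : I -> C) : Prop :=
  forall y, in_p y -> phi_ev phi (bracket x y) = 0.

Definition lin_ev (psi : I -> C) (x : I -> C) : C := \sum_k x k * psi k.

(* phi' (restricted to g^phi) is a Lie algebra homomorphism g^phi -> C
   extending phi *)
Definition extends_phi (phi psi : I -> C) : Prop :=
  (forall x, in_p x -> lin_ev psi x = phi_ev phi x) /\
  (forall x y, in_gphi phi x -> in_gphi phi y -> lin_ev psi (bracket x y) = 0).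

End LieFramework.

(* sl_2 with basis e = 0, h = 1, f = 2                                        *)
Definition sl2_br (a b c : 'I_3) : C :=
  match nat_of_ord a, nat_of_ord b, nat_of_ord c with
  | 1, 0, 0 => 2
  | 0, 1, 0 => -2
  | 1, 2, 2 => -2
  | 2, 1, 2 => 2
  | 0, 2, 1 => 1
  | 2, 0, 1 => -1
  | _, _, _ => 0
  end.

(* (a) Conformal Galilei algebra g^(l), with m = 2l.
   Basis: inl a (a : 'I_3, sl_2 part), inr k = p_k (k = 0..m).                *)
Definition galI (m : nat) : finType := ('I_3 + 'I_m.+1)%type.

(* coefficient of p_j in [a, p_k] *)
Definition galp (m : nat) (a : 'I_3) (k j : 'I_m.+1) : C :=
  match nat_of_ord a with
  | 0 => if (j.+1 == k)%N then k%:R else 0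
  | 1 => if j == k then ((m%:Z - (2 * k)%:Z)%:~R : C) else 0
  | _ => if (nat_of_ord j == k.+1)%N then (m - k)%:R else 0
  end.

Definition gal_br (m : nat) (x y z : galI m) : C :=
  match x, y, z with
  | inl a, inl b, inl c => sl2_br a b c
  | inl a, inr k, inr j => galp a k j
  | inr k, inl a, inr j => - galp a k j
  | _, _, _ => 0
  end.

Definition gal_p (m : nat) : pred (galI m) :=
  fun z => if z is inr _ then true else false.

(* (b) Schroedinger algebra sch_n.
   Basis: inl (inl (inl a)) sl_2 part; inl (inl (inr i)) = x_i;
          inl (inr i) = y_i; inr tt = z.                                      *)
Definition schI (n : nat) : finType := ('I_3 + 'I_n + 'I_n + unit)%type.

(* coefficient of t in [a, s], where false = x-type, true = y-type *)
Definition sl2V (a : 'I_3) (s t : bool) : C :=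
  match nat_of_ord a, s, t with
  | 1, false, false => 1
  | 1, true, true => -1
  | 2, false, true => 1
  | 0, true, false => 1
  | _, _, _ => 0
  end.

Definition sch_br (n : nat) (u v w : schI n) : C :=
  match u, v, w with
  | inl (inl (inl a)), inl (inl (inl b)), inl (inl (inl c)) => sl2_br a b c
  | inl (inl (inl a)), inl (inl (inr i)), inl (inl (inr j)) => (i == j)%:R * sl2V a false false
  | inl (inl (inl a)), inl (inl (inr i)), inl (inr j) => (i == j)%:R * sl2V a false true
  | inl (inl (inl a)), inl (inr i), inl (inl (inr j)) => (i == j)%:R * sl2V a true false
  | inl (inl (inl a)), inl (inr i), inl (inr j) => (i == j)%:R * sl2V a true true
  | inl (inl (inr i)), inl (inl (inl a)), inl (inl (inr j)) => - ((i == j)%:R * sl2V a false false)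
  | inl (inl (inr i)), inl (inl (inl a)), inl (inr j) => - ((i == j)%:R * sl2V a false true)
  | inl (inr i), inl (inl (inl a)), inl (inl (inr j)) => - ((i == j)%:R * sl2V a true false)
  | inl (inr i), inl (inl (inl a)), inl (inr j) => - ((i == j)%:R * sl2V a true true)
  | inl (inl (inr i)), inl (inr j), inr _ => (i == j)%:R
  | inl (inr j), inl (inl (inr i)), inr _ => - (i == j)%:R
  | _, _, _ => 0
  end.

Definition sch_p (n : nat) : pred (schI n) :=
  fun u => if u is inl (inl (inl _)) then false else true.

Arguments gal_p : clear implicits.
Arguments sch_p : clear implicits.

(* Main.v *)
(* In a module generated by a line C w on which g^phi acts by a character
   extending phi, filter by the number of elements of g applied to w.  On the
   associated graded module the operators p - phi(p) act as derivations, and a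
   generalised inverse of the pairing (x, p) |-> phi([x, p]) assembles them into
   an Euler operator.  Hence every vector of type phi lies on the line and every
   nonzero submodule meets it; no PBW theorem is needed.  Blandness is immediate,
   and the universal property follows because the submodule of V * M generated by
   (w, m) is then the graph of a map.
   The line exists because g^phi / p has dimension at most one: if s spans it,
   V_phi is a simple C[s]-module, so w = q(s) s w for some polynomial q unless
   s w = 0, and w is killed by the nonzero polynomial 1 - X q in s, which gives an
   eigenvector.  When g^phi = p, W(phi) is the module V(phi') with phi' = phi, so
   the second alternative of the conclusion always holds. *)
Require Import Defs.
From mathcomp Require Import all_boot all_order all_algebra.
From mathcomp Require Import ssrAC boolp.
Set Implicit Arguments. Unset Strict Implicit. Unset Printing Implicit Defensive.
Import GRing.Theory Num.Theory.
Local Open Scope ring_scope.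

(** * Generalised inverses and sums against basis vectors *)

Lemma exists_ginv (F : fieldType) (I : finType) (A : I -> I -> F) :
  exists G : I -> I -> F, forall a b,
    \sum_i (\sum_k A a k * G k i) * A i b = A a b.
Proof.
pose M : 'M[F]_#|I| := \matrix_(i, j) A (enum_val i) (enum_val j).
exists (fun k i => pinvmx M (enum_rank k) (enum_rank i)) => a b.
(* The row space of [M] lies in itself, so [pinvmx M] satisfies M M^+ M = M, the claim in matrix
   form. *)
have /matrixP /(_ (enum_rank a) (enum_rank b)) := mulmxKpV (submx_refl M).
rewrite !mxE !enum_rankK => <-.
rewrite (reindex (@enum_val I predT)) /=; last exact/onW_bij/enum_val_bij.
apply: eq_bigr => i _; rewrite !mxE enum_valK; congr (_ * _); last by rewrite enum_rankK.
rewrite (reindex (@enum_val I predT)) /=; last exact/onW_bij/enum_val_bij.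
by apply: eq_bigr => k _; rewrite !mxE enum_valK enum_rankK.
Qed.

Lemma sum_delta (R : pzSemiRingType) (I : finType) (F : I -> R) (Q : pred I) i :
  Q i -> \sum_(j | Q j) (j == i)%:R * F j = F i.
Proof.
move=> Qi; rewrite (bigD1 i) //= eqxx mul1r big1 ?addr0 // => j.
by case/andP => _ /negbTE ->; rewrite mul0r.
Qed.

Lemma sum_bvec (I : finType) (F : I -> C) (Q : pred I) i :
  Q i -> \sum_(j | Q j) bvec i j * F j = F i.
Proof. exact: sum_delta. Qed.

(** * Calculus in a g-module *)

Section GModule.
Variables (I : finType) (br : I -> I -> I -> C) (V : lmodType C) (rho : I -> V -> V).
Hypothesis gmV : is_gmodule br rho.

Lemma rho_semilinear i : scalable (rho i) * {morph rho i : u v / u + v}.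
Proof.
have h1 u v : rho i (u + v) = rho i u + rho i v.
  by have := gmV.1 i 1 u v; rewrite !scale1r.
have h0 : rho i 0 = 0 by apply: (@addrI _ (rho i 0)); rewrite -h1 !addr0.
by split=> // a u; have := gmV.1 i a u 0; rewrite h0 !addr0.
Qed.

Lemma rhoD i u v : rho i (u + v) = rho i u + rho i v.
Proof. exact: (rho_semilinear i).2. Qed.

Lemma rhoZ i a u : rho i (a *: u) = a *: rho i u.
Proof. exact: (rho_semilinear i).1. Qed.

Lemma rho0 i : rho i 0 = 0.
Proof. by rewrite -(scale0r 0) rhoZ !scale0r. Qed.

Lemma rhoB i u v : rho i (u - v) = rho i u - rho i v.
Proof. by rewrite rhoD -scaleN1r rhoZ scaleN1r. Qed.

Lemma rho_sum i (J : finType) (Q : pred J) (F : J -> V) :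
  rho i (\sum_(j | Q j) F j) = \sum_(j | Q j) rho i (F j).
Proof. exact: (big_morph (rho i) (rhoD i) (rho0 i)). Qed.

Lemma rhoC i j v : rho i (rho j v) = rho j (rho i v) + \sum_k br i j k *: rho k v.
Proof. by rewrite -gmV.2 addrC subrK. Qed.

Lemma actD x u v : act rho x (u + v) = act rho x u + act rho x v.
Proof. by rewrite -big_split; apply: eq_bigr => i _; rewrite rhoD scalerDr. Qed.

Lemma actZ x a u : act rho x (a *: u) = a *: act rho x u.
Proof.
by rewrite /act scaler_sumr; apply: eq_bigr => i _; rewrite rhoZ !scalerA mulrC.
Qed.

Lemma act0 x : act rho x 0 = 0.
Proof. by rewrite -(scale0r 0) actZ !scale0r. Qed.

Lemma act_bvec i v : act rho (bvec i) v = rho i v.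
Proof.
rewrite /act (bigD1 i) //= /bvec eqxx scale1r big1 ?addr0 // => j /negbTE ->.
by rewrite scale0r.
Qed.

(** The coordinate vector in the last term is [x, k], so this is the module relation for a general
    element x. *)
Lemma act_rho x k v : act rho x (rho k v) =
  rho k (act rho x v) + act rho (fun j => \sum_i x i * br i k j) v.
Proof.
rewrite {1 2}/act rho_sum.
under eq_bigr do rewrite rhoC scalerDr.
rewrite big_split /=; congr (_ + _).
  by apply: eq_bigr => i _; rewrite rhoZ.
under [RHS]eq_bigr do rewrite scaler_suml.
rewrite exchange_big; apply: eq_bigr => i _ /=.
by rewrite scaler_sumr; apply: eq_bigr => j _; rewrite scalerA.
Qed.

End GModule.

(** * The filtration attached to an ideal p and its Euler operator *)

Section Ideal.
Variables (I : finType) (br : I -> I -> I -> C) (P : pred I) (phi : I -> C).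
Hypothesis anti : forall i j k, br i j k = - br j i k.
Hypothesis idealP : forall i j k, P j -> ~~ P k -> br i j k = 0.

(** The matrix of the pairing (x, p) |-> phi([x, p]); for [P j] the bracket lies in p, so [phi_ev]
    truncates nothing. *)
Let cphi i j := phi_ev P phi (br i j).

Lemma phi_ev_sum (J : finType) (c : J -> C) (F : J -> I -> C) :
  phi_ev P phi (fun k => \sum_j c j * F j k) = \sum_j c j * phi_ev P phi (F j).
Proof.
rewrite /phi_ev; under eq_bigr do rewrite mulr_suml.
rewrite exchange_big; apply: eq_bigr => j _ /=.
by rewrite mulr_sumr; apply: eq_bigr => k _; rewrite mulrA.
Qed.

Lemma phi_ev_anti i j : cphi i j = - cphi j i.
Proof.
by rewrite /cphi /phi_ev -sumrN; apply: eq_bigr => k _; rewrite anti mulNr.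
Qed.

Lemma phi_ev_bracket x y :
  phi_ev P phi (bracket br x y) = \sum_i \sum_j x i * y j * cphi i j.
Proof.
have -> : bracket br x y = fun k => \sum_i x i * \sum_j y j * br i j k.
  apply: funext => k; apply: eq_bigr => i _; rewrite mulr_sumr.
  by apply: eq_bigr => j _; rewrite mulrA.
rewrite phi_ev_sum; apply: eq_bigr => i _.
by rewrite phi_ev_sum mulr_sumr; apply: eq_bigr => j _; rewrite mulrA.
Qed.

Lemma in_p_bvec k : P k -> in_p P (bvec k).
Proof. by move=> Pk j; rewrite /bvec; case: eqP => // -> /negP. Qed.

Lemma in_gphiP x : in_gphi br P phi x <->
  forall j, P j -> \sum_i x i * phi_ev P phi (br i j) = 0.
Proof.
split=> [xg j Pj|h y yp].
  rewrite -[RHS](xg _ (in_p_bvec Pj)) phi_ev_bracket; apply: eq_bigr => i _.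
  rewrite -(sum_bvec (fun j => x i * phi_ev P phi (br i j)) (i := j) (Q := predT)) //.
  by apply: eq_bigr => k _; rewrite mulrCA mulrA.
rewrite phi_ev_bracket exchange_big big1 // => j _ /=.
transitivity (y j * \sum_i x i * cphi i j).
  by rewrite mulr_sumr; apply: eq_bigr => i _; rewrite -mulrA mulrCA.
have [Pj|nPj] := boolP (P j); last by rewrite yp ?mul0r.
by rewrite h // mulr0.
Qed.

Lemma in_gphi_comb a b x y : in_gphi br P phi x -> in_gphi br P phi y ->
  in_gphi br P phi (fun i => a * x i + b * y i).
Proof.
move=> /in_gphiP xg /in_gphiP yg; apply/in_gphiP => j Pj.
transitivity (a * (\sum_i x i * cphi i j) + b * (\sum_i y i * cphi i j)).
  rewrite !mulr_sumr -big_split; apply: eq_bigr => i _.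
  by rewrite mulrDl !mulrA.
by rewrite /cphi xg // yg // !mulr0 addr0.
Qed.

Section Module.
Variables (V : lmodType C) (rho : I -> V -> V).
Hypothesis gmV : is_gmodule br rho.

Lemma in_VphiP v :
  in_Vphi P rho phi v <-> forall k, P k -> rho k v = phi k *: v.
Proof.
split=> [h k Pk|h x xp].
  have := h _ (in_p_bvec Pk); rewrite act_bvec // => ->; congr (_ *: _).
  exact: (sum_bvec phi).
rewrite /act /phi_ev (bigID P) /= [X in _ + X]big1 ?addr0.
  by rewrite scaler_suml; apply: eq_bigr => k Pk; rewrite h // scalerA.
by move=> k nPk; rewrite xp // scale0r.
Qed.

(** [B] stays abstract because the argument is applied twice: to a line C w and, before any
    eigenvector is known, to C[s] s w. *)
Variable B : V -> Prop.
Hypotheses (B0 : B 0) (BD : forall u v, B u -> B v -> B (u + v))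
  (BZ : forall a v, B v -> B (a *: v)).
Hypothesis Bphi : forall v, B v -> in_Vphi P rho phi v.
Hypothesis Bg : forall x v, in_gphi br P phi x -> B v -> B (act rho x v).

(* The filtration of the submodule generated by B by the number of applied
   basis elements, shifted by one: filt 0 is zero and filt 1 is B. *)
Inductive filt : nat -> V -> Prop :=
| filt_0 d : filt d 0
| filt_B d v : B v -> filt d.+1 v
| filt_D d u v : filt d u -> filt d v -> filt d (u + v)
| filt_Z d a v : filt d v -> filt d (a *: v)
| filt_rho d i v : filt d v -> filt d.+1 (rho i v).

Lemma filt_sum d (J : finType) (Q : pred J) (F : J -> V) :
  (forall j, Q j -> filt d (F j)) -> filt d (\sum_(j | Q j) F j).
Proof. by move=> h; elim/big_ind: _ => //; [apply: filt_0|apply: filt_D]. Qed.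

(** Both levels are treated together: a word [rho i v] at level 1 has v at level 0 and hence
    vanishes. *)
Lemma filt_inv d v : filt d v -> (d = 0%N -> v = 0) /\ (d = 1%N -> B v).
Proof.
elim=> {d v}.
- by [].
- by [].
- move=> d u v _ [u0 u1] _ [v0 v1]; split=> dE.
    by rewrite u0 // v0 // addr0.
  by apply: BD; [apply: u1|apply: v1].
- move=> d a v _ [v0 v1]; split=> dE; first by rewrite v0 // scaler0.
  by apply: BZ; apply: v1.
- by move=> d i v _ [v0 _]; split=> // -[dE]; rewrite v0 // (rho0 gmV).
Qed.

Lemma filt0 v : filt 0 v -> v = 0. Proof. by case/filt_inv => ->. Qed.

Lemma filt1 v : filt 1 v -> B v. Proof. by case/filt_inv => _; apply. Qed.

Lemma filtS d v : filt d v -> filt d.+1 v.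
Proof.
by elim=> {d v} *; [apply: filt_0|apply: filt_B|apply: filt_D|apply: filt_Z|apply: filt_rho].
Qed.

Lemma filt_le d e v : (d <= e)%N -> filt d v -> filt e v.
Proof.
move=> /subnKC <-; elim: (e - d)%N => [|k IH] fv; first by rewrite addn0.
by rewrite addnS; apply/filtS/IH.
Qed.

Lemma filt_predn_rho d i v : filt d.-1 v -> filt d (rho i v).
Proof. by case: d => [/filt0 ->|d]; [rewrite (rho0 gmV); apply: filt_0|apply: filt_rho]. Qed.

Definition shift k (u : V) := rho k u - phi k *: u.

(** As p is an ideal, [k, a] lies in p; replacing each basis vector c in it by [shift c] plus phi(c)
    leaves the scalar phi([k, a]) = - [cphi a k]. *)
Lemma shift_rho k a u : P k -> shift k (rho a u) =
  rho a (shift k u) + (\sum_(c | P c) br k a c *: shift c u) - cphi a k *: u.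
Proof.
move=> Pk; rewrite /shift (rhoC gmV) (rhoB gmV) (rhoZ gmV) addrAC -!addrA; congr (_ + (_ + _)).
rewrite -scaleNr -phi_ev_anti /cphi /phi_ev scaler_suml -big_split /=.
rewrite (bigID P) /= [X in _ + X]big1 ?addr0.
  by apply: eq_bigr => c _; rewrite scalerBr scalerA subrK.
by move=> c nPc; rewrite anti idealP // oppr0 scale0r.
Qed.

Lemma shiftD k u v : shift k (u + v) = shift k u + shift k v.
Proof. by rewrite /shift (rhoD gmV) scalerDr opprD addrACA. Qed.

Lemma shiftZ k a v : shift k (a *: v) = a *: shift k v.
Proof. by rewrite /shift (rhoZ gmV) scalerBr !scalerA mulrC. Qed.

(** A shift kills [B], and moving it past a letter only costs terms with that letter removed. The
    induction keeps k general because the bracket brings in shifts by other elements of p. *)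
Lemma filt_shift d u k : P k -> filt d u -> filt d.-1 (shift k u).
Proof.
move=> Pk fu; elim: fu k Pk => {d u}.
- by move=> d k Pk; rewrite /shift (rho0 gmV) scaler0 subrr; apply: filt_0.
- move=> d v Bv k Pk; rewrite /shift; have /in_VphiP -> // := Bphi Bv.
  by rewrite subrr; apply: filt_0.
- move=> d u v _ IHu _ IHv k Pk; rewrite shiftD.
  by apply: filt_D; [apply: IHu|apply: IHv].
- by move=> d a v _ IH k Pk; rewrite shiftZ; apply/filt_Z/IH.
- move=> d i v fv IH k Pk /=; rewrite shift_rho // -scaleNr.
  apply: filt_D; last exact: filt_Z.
  apply: filt_D; first exact/filt_predn_rho/IH.
  by apply: filt_sum => c Pc; apply/filt_Z/(filt_le _ (IH _ Pc))/leq_pred.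
Qed.

Lemma filt_act d u x : filt d u -> filt d.+1 (act rho x u).
Proof. by move=> fu; apply: filt_sum => i _; apply/filt_Z/filt_rho. Qed.

(** [Bg] settles [B]; past a letter i, the commutator [x, i] takes the place of i, so the level does
    not grow. *)
Lemma filt_gphi d u x : in_gphi br P phi x -> filt d u -> filt d (act rho x u).
Proof.
move=> xg; elim=> {d u}.
- by move=> d; rewrite (act0 gmV); apply: filt_0.
- by move=> d v Bv; apply/filt_B/Bg.
- by move=> d u v _ IHu _ IHv; rewrite (actD gmV); apply: filt_D.
- by move=> d a v _ IH; rewrite (actZ gmV); apply: filt_Z.
- move=> d i v fv IH; rewrite (act_rho gmV).
  by apply: filt_D; [apply: filt_rho|apply: filt_act].
Qed.

(* Modulo lower terms, shift k acts on words as the derivation a |-> - cphi a k;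
   a generalised inverse G of cphi turns this into an Euler operator. *)
Section Euler.
Variable G : I -> I -> C.
Hypothesis GP : forall a b, P b ->
  \sum_i (\sum_(k | P k) cphi a k * G k i) * cphi i b = cphi a b.

Definition euler u := \sum_(k | P k) \sum_i G k i *: rho i (shift k u).

(** By [GP] the letter a and its projection have the same pairing with p, so their difference acts
    without raising the level. *)
Lemma euler_sub_gphi a :
  in_gphi br P phi (fun j => bvec a j - \sum_(k | P k) cphi a k * G k j).
Proof.
apply/in_gphiP => b Pb.
under eq_bigr do rewrite mulrBl.
by rewrite sumrB GP // (sum_bvec (fun i => phi_ev P phi (br i b))) ?subrr.
Qed.

Lemma eulerD u v : euler (u + v) = euler u + euler v.
Proof.
rewrite -big_split; apply: eq_bigr => k _ /=; rewrite -big_split.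
by apply: eq_bigr => i _ /=; rewrite shiftD (rhoD gmV) scalerDr.
Qed.

Lemma eulerZ a v : euler (a *: v) = a *: euler v.
Proof.
rewrite /euler scaler_sumr; apply: eq_bigr => k _; rewrite scaler_sumr.
by apply: eq_bigr => i _; rewrite shiftZ (rhoZ gmV) !scalerA mulrC.
Qed.

Lemma euler_prim u : (forall k, P k -> shift k u = 0) -> euler u = 0.
Proof.
by move=> h; apply: big1 => k Pk; apply: big1 => i _; rewrite h // (rho0 gmV) scaler0.
Qed.

(** Moving [rho a] out of [euler] produces minus the projection of the letter a, which is a up to an
    element of g^phi; this isolates - [rho a u]. Every term of the double sum contains a shift of u
    and is of lower order. *)
Lemma euler_rho a u : euler (rho a u) = rho a (euler u) - rho a u
  + act rho (fun j => bvec a j - \sum_(k | P k) cphi a k * G k j) u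
  + \sum_(k | P k) \sum_i G k i *:
      (\sum_c br i a c *: rho c (shift k u)
       + rho i (\sum_(c | P c) br k a c *: shift c u)).
Proof.
have -> : act rho (fun j => bvec a j - \sum_(k | P k) cphi a k * G k j) u
  = rho a u - \sum_(k | P k) \sum_i (G k i * cphi a k) *: rho i u.
  rewrite -(act_bvec rho a u) /act exchange_big -sumrB; apply: eq_bigr => i _.
  rewrite scalerBl scaler_suml; congr (_ - _); apply: eq_bigr => k _.
  by rewrite mulrC.
rewrite addrA subrK /euler (rho_sum gmV) -sumrB -big_split; apply: eq_bigr => k Pk /=.
rewrite (rho_sum gmV) -sumrB -big_split; apply: eq_bigr => i _ /=.
rewrite shift_rho // (rhoB gmV) (rhoD gmV) (rhoZ gmV) (rhoZ gmV) (rhoC gmV i a).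
by rewrite scalerBr !scalerDr scalerA -!addrA; congr (_ + _); rewrite addrA addrC.
Qed.

(** Level d holds words of at most d - 1 letters, so the Euler operator is - (d - 1) there modulo
    the level below. *)
Lemma filt_euler d u : filt d u -> filt d.-1 (euler u + d.-1%:R *: u).
Proof.
elim=> {d u}.
- move=> d; rewrite euler_prim ?scaler0 ?addr0; first exact: filt_0.
  by move=> k _; rewrite /shift (rho0 gmV) scaler0 subrr.
- move=> d v Bv; rewrite euler_prim ?add0r.
    case: d => [|d]; first by rewrite scale0r; apply: filt_0.
    by apply/filt_Z/filt_B.
  by move=> k Pk; have /in_VphiP h := Bphi Bv; rewrite /shift h // subrr.
- move=> d u v _ IHu _ IHv; rewrite eulerD scalerDr addrACA.
  exact: filt_D.
- by move=> d a v _ IH; rewrite eulerZ scalerA mulrC -scalerA -scalerDr; apply: filt_Z.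
- move=> d a u fu IH /=; case: d fu IH => [/filt0 -> _|d fu IH].
    rewrite (rho0 gmV) scale0r addr0 euler_prim; first exact: filt_0.
    by move=> k _; rewrite /shift (rho0 gmV) scaler0 subrr.
  rewrite euler_rho -natr1 scalerDl scale1r.
  rewrite [_ + rho a u]addrC !addrA.
  set X := act _ _ _; set Y := \sum_(k | P k) _.
  (* The - [rho a u] of [euler_rho] cancels the 1 in d + 1; what remains is the induction hypothesis
     under [rho a], a g^phi term and shifts of u. *)
  have -> : rho a (euler u) - rho a u + X + Y + rho a u + d%:R *: rho a u
    = rho a (euler u + d%:R *: u) + X + Y.
    by rewrite (rhoD gmV) (rhoZ gmV) [LHS](AC 6 (1*6*3*4*(2*5))) /= addNr addr0.
  apply: filt_D; last first.
    apply: filt_sum => k Pk; apply: filt_sum => i _; apply: filt_Z.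
    have fs c : P c -> filt d (shift c u) by move=> Pc; apply: (filt_shift Pc fu).
    apply: filt_D.
      by apply: filt_sum => c _; apply/filt_Z/filt_rho/fs.
    by apply: filt_rho; apply: filt_sum => c Pc; apply/filt_Z/fs.
  apply: filt_D; first exact: filt_rho.
  exact/filt_gphi/fu/euler_sub_gphi.
Qed.

End Euler.

(** Shifts kill such a u, so [euler u] = 0 and, for u at level d + 2, (d + 1) u lies at level d + 1;
    dividing by d + 1 descends to level 1, which is [B]. *)
Lemma filt_prim d u : filt d u -> in_Vphi P rho phi u -> B u.
Proof.
(* The factor [(P k)%:R] blanks the columns outside p, so that the sum over k can be restricted to
   p. *)
have [G0 GP0] := exists_ginv (fun i k => (P k)%:R * cphi i k).
have GP a b : P b ->
    \sum_i (\sum_(k | P k) cphi a k * G0 k i) * cphi i b = cphi a b.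
  move=> Pb; have := GP0 a b; rewrite Pb mul1r => <-; apply: eq_bigr => i _.
  rewrite mul1r big_mkcond; congr (_ * _); apply: eq_bigr => k _.
  by case: (P k); rewrite ?mul1r ?mul0r.
move=> fu /in_VphiP up; elim: d fu => [/filt0 -> //|[_ /filt1 //|d IH] fu].
apply: IH; have := filt_euler GP fu.
rewrite euler_prim ?add0r; last by move=> k Pk; rewrite /shift up // subrr.
move=> /(filt_Z (d.+1%:R^-1)); rewrite scalerA mulVf ?scale1r //.
by rewrite pnatr_eq0.
Qed.

(** Shifts preserve [S] and lower the level, so finitely many of them lead to a nonzero vector
    killed by all shifts, which [filt_prim] places in [B]. *)
Lemma filt_socle (S : V -> Prop) d u : is_submodule rho S ->
  filt d u -> S u -> u <> 0 -> exists b, [/\ B b, S b & b <> 0].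
Proof.
move=> [S0 SD SZ Sr]; elim: d u => [u /filt0 -> //|d IH u fu Su u0].
have [|] := pselect (exists2 k, P k & shift k u <> 0).
  move=> [k Pk ku0]; apply: IH ku0; first exact: (filt_shift Pk fu).
  by rewrite /shift -scaleNr; apply: SD; [apply: Sr|apply: SZ].
move=> h; exists u; split=> //; apply: (filt_prim fu); apply/in_VphiP => k Pk.
by apply/eqP; rewrite -subr_eq0; apply/eqP; apply: contrapT => ?; apply: h; exists k.
Qed.

Definition span_module v := exists d, filt d v.

Lemma span_submodule : is_submodule rho span_module.
Proof.
split.
- by exists 0%N; apply: filt_0.
- move=> u v [d fu] [e fv]; exists (maxn d e).
  by apply: filt_D; [apply: filt_le fu; apply: leq_maxl|apply: filt_le fv; apply: leq_maxr].
- by move=> a v [d fv]; exists d; apply: filt_Z.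
- by move=> i v [d fv]; exists d.+1; apply: filt_rho.
Qed.

Lemma span_B v : B v -> span_module v.
Proof. by exists 1%N; apply: filt_B. Qed.

End Module.
End Ideal.

(** * Polynomials in one operator *)

Section PolyAct.
Variables (F : closedFieldType) (V : lmodType F) (sigma : V -> V).
Hypothesis sigmaD : forall u v, sigma (u + v) = sigma u + sigma v.
Hypothesis sigmaZ : forall a v, sigma (a *: v) = a *: sigma v.

Definition poly_act (q : {poly F}) (v : V) : V :=
  \sum_(i < size q) q`_i *: iter i sigma v.

Lemma poly_act_widen n (q : {poly F}) v : (size q <= n)%N ->
  poly_act q v = \sum_(i < n) q`_i *: iter i sigma v.
Proof.
move=> qn; rewrite /poly_act (big_ord_widen n (fun i => q`_i *: iter i sigma v)) //.
rewrite big_mkcond; apply: eq_bigr => i _.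
by case: ltnP => // qi; rewrite nth_default // scale0r.
Qed.

Lemma poly_actD p q v : poly_act (p + q) v = poly_act p v + poly_act q v.
Proof.
pose n := maxn (size p) (size q).
rewrite (@poly_act_widen n) ?size_polyD // (@poly_act_widen n p) ?leq_maxl //.
rewrite (@poly_act_widen n q) ?leq_maxr // -big_split; apply: eq_bigr => i _ /=.
by rewrite coefD scalerDl.
Qed.

Lemma poly_actZ a q v : poly_act (a *: q) v = a *: poly_act q v.
Proof.
rewrite (@poly_act_widen (size q)) ?size_scale_leq // scaler_sumr.
by apply: eq_bigr => i _; rewrite coefZ scalerA.
Qed.

Lemma poly_act1 v : poly_act 1 v = v.
Proof. by rewrite /poly_act size_poly1 big_ord1 coef1 scale1r. Qed.

Lemma poly_act_comp q v : poly_act ('X * q) v = poly_act q (sigma v).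
Proof.
rewrite (@poly_act_widen (size q).+1); last first.
  by rewrite (leq_trans (size_polyMleq _ _)) // size_polyX.
rewrite big_ord_recl coefXM scale0r add0r; apply: eq_bigr => i _.
by rewrite lift0 coefXM iterSr.
Qed.

Lemma poly_actXM q v : poly_act ('X * q) v = sigma (poly_act q v).
Proof.
have s0 : sigma 0 = 0 by rewrite -(scale0r 0) sigmaZ !scale0r.
rewrite poly_act_comp /poly_act (big_morph sigma sigmaD s0).
by apply: eq_bigr => i _; rewrite sigmaZ -iterS iterSr.
Qed.

(** Split q into linear factors and remove them one at a time: when the remaining product r first
    fails to kill v, the factor X - a just removed gives the eigenvalue. *)
Lemma poly_act_eigen q v : q != 0 -> v <> 0 -> poly_act q v = 0 ->
  exists r a, poly_act r v <> 0 /\ sigma (poly_act r v) = a *: poly_act r v.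
Proof.
move=> q0 v0; have [rs ->] := closed_field_poly_normal q.
rewrite poly_actZ => /eqP; rewrite scaler_eq0 lead_coef_eq0 (negbTE q0) /=.
elim: rs => [|a rs IH]; first by rewrite big_nil poly_act1 => /eqP.
rewrite big_cons mulrBl -scaleN1r poly_actD poly_actZ poly_actXM scaleN1r.
rewrite mul_polyC poly_actZ subr_eq0 => /eqP sE.
by have [/IH //|/eqP r0] := boolP (poly_act (\prod_(z <- rs) ('X - z%:P)) v == 0);
   exists (\prod_(z <- rs) ('X - z%:P)), a.
Qed.

End PolyAct.

(** * Lines on which g^phi acts by a character *)

Section Character.
Variables (I : finType) (br : I -> I -> I -> C) (P : pred I) (phi : I -> C).
Hypothesis anti : forall i j k, br i j k = - br j i k.
Hypothesis idealP : forall i j k, P j -> ~~ P k -> br i j k = 0.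
Hypothesis phi_hom : is_lie_hom_p br P phi.

Lemma in_p_gphi x : in_p P x -> in_gphi br P phi x.
Proof. by move=> xp y; apply: phi_hom. Qed.

Lemma bracket_in_p x y : in_p P y -> in_p P (bracket br x y).
Proof.
move=> yp k nPk; rewrite /bracket; apply: big1 => i _; apply: big1 => j _.
by have [Pj|/yp ->] := boolP (P j); [rewrite idealP // mulr0|rewrite mulr0 mul0r].
Qed.

Lemma bracketC x y k : bracket br x y k = - bracket br y x k.
Proof.
rewrite /bracket exchange_big -sumrN; apply: eq_bigr => i _.
by rewrite -sumrN; apply: eq_bigr => j _; rewrite anti mulrN (mulrC (x j)).
Qed.

Lemma bracketxx x k : bracket br x x k = 0.
Proof.
apply/eqP; have /eqP := bracketC x x k.
by rewrite -addr_eq0 -mulr2n mulrn_eq0.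
Qed.

Lemma bracket_comb a b x y z k :
  bracket br z (fun i => a * x i + b * y i) k
  = a * bracket br z x k + b * bracket br z y k.
Proof.
rewrite /bracket !mulr_sumr -big_split; apply: eq_bigr => i _.
rewrite !mulr_sumr -big_split; apply: eq_bigr => j _ /=.
by rewrite mulrDr mulrDl (mulrCA _ a) (mulrCA _ b) !mulrA.
Qed.

Lemma phi_ev_comb a b x y : phi_ev P phi (fun i => a * x i + b * y i)
  = a * phi_ev P phi x + b * phi_ev P phi y.
Proof.
rewrite /phi_ev !mulr_sumr -big_split; apply: eq_bigr => i _.
by rewrite mulrDl !mulrA.
Qed.

Section LineModule.
Variables (V : lmodType C) (rho : I -> V -> V) (w : V) (psi : I -> C).
Hypothesis gmV : is_gmodule br rho.
Hypothesis psi_ext : extends_phi br P phi psi.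
Hypothesis wE : forall x, in_gphi br P phi x -> act rho x w = lin_ev psi x *: w.

Definition line v := exists a : C, v = a *: w.

Lemma line0 : line 0. Proof. by exists 0; rewrite scale0r. Qed.

Lemma lineD u v : line u -> line v -> line (u + v).
Proof. by move=> [a ->] [b ->]; exists (a + b); rewrite scalerDl. Qed.

Lemma lineZ a v : line v -> line (a *: v).
Proof. by move=> [b ->]; exists (a * b); rewrite scalerA. Qed.

Lemma line_Vphi v : line v -> in_Vphi P rho phi v.
Proof.
move=> [a ->] x xp; rewrite (actZ gmV) wE ?psi_ext.1 //; last exact: in_p_gphi.
by rewrite !scalerA mulrC.
Qed.

Lemma line_gphi x v : in_gphi br P phi x -> line v -> line (act rho x v).
Proof. by move=> xg [a ->]; rewrite (actZ gmV) wE // scalerA; exists (a * lin_ev psi x). Qed.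

Definition line_span := span_module rho line.

Lemma line_spanE v : line_span v -> in_Vphi P rho phi v -> line v.
Proof.
by case=> d; apply: (filt_prim anti idealP gmV line0 lineD lineZ line_Vphi line_gphi).
Qed.

Lemma line_span_submodule : is_submodule rho line_span.
Proof. exact: span_submodule. Qed.

Lemma line_span_w : line_span w.
Proof. by apply: span_B; exists 1; rewrite scale1r. Qed.

Lemma line_span_socle S v : is_submodule rho S -> line_span v -> S v -> v <> 0 ->
  exists b, [/\ line b, S b & b <> 0].
Proof.
move=> Ssub [d fv].
exact: (filt_socle anti idealP gmV line0 lineD lineZ line_Vphi line_gphi Ssub fv).
Qed.

End LineModule.

Definition prod_rho (V M : lmodType C) (rho : I -> V -> V) (rhoM : I -> M -> M)
  (i : I) (p : (V * M)%type) : (V * M)%type := (rho i p.1, rhoM i p.2).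

Lemma fst_sum (V M : lmodType C) (J : finType) (F : J -> (V * M)%type) :
  (\sum_j F j).1 = \sum_j (F j).1.
Proof. exact: (big_morph fst). Qed.

Lemma snd_sum (V M : lmodType C) (J : finType) (F : J -> (V * M)%type) :
  (\sum_j F j).2 = \sum_j (F j).2.
Proof. exact: (big_morph snd). Qed.

Lemma prod_gmodule (V M : lmodType C) rho rhoM :
  @is_gmodule I br V rho -> @is_gmodule I br M rhoM ->
  @is_gmodule I br (V * M)%type (prod_rho rho rhoM).
Proof.
move=> gV gM; split=> [i a [u u'] [v v']|i j [v v']].
  by rewrite /prod_rho /= gV.1 gM.1.
apply: injective_projections; rewrite /prod_rho /=.
  by rewrite fst_sum /= gV.2.
by rewrite snd_sum /= gM.2.
Qed.

(** * Irreducible modules: blandness, universal property, existence of the character *)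

Section Irreducible.
Variables (V : lmodType C) (rho : I -> V -> V).
Hypotheses (gmV : is_gmodule br rho) (irrV : irreducible rho).

Lemma irr_full (S : V -> Prop) v : is_submodule rho S -> S v -> v <> 0 ->
  forall u, S u.
Proof. by move=> /irrV.2 [S0|//] /S0. Qed.

Section Line.
Variables (w : V) (psi : I -> C).
Hypothesis w0 : w <> 0.
Hypothesis psi_ext : extends_phi br P phi psi.
Hypothesis wE : forall x, in_gphi br P phi x -> act rho x w = lin_ev psi x *: w.

Lemma bland_line : bland P rho phi.
Proof.
split=> //; exists w; split=> //.
  by apply: (line_Vphi gmV psi_ext wE); exists 1; rewrite scale1r.
move=> v; apply: (line_spanE gmV psi_ext wE).
exact: (irr_full (line_span_submodule _ _) (line_span_w _ _)).
Qed.

Lemma iso_induced_line :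
  iso_induced br rho (in_gphi br P phi) (lin_ev psi).
Proof.
exists w; split=> // M rhoM gmM m mE.
pose rhoX := prod_rho rho rhoM.
have gmX : is_gmodule br rhoX by apply: prod_gmodule.
have XE x : in_gphi br P phi x -> act rhoX x (w, m) = lin_ev psi x *: (w, m).
  move=> xg; apply: injective_projections; rewrite /act.
    by rewrite fst_sum /= -wE.
  by rewrite snd_sum /= -mE.
pose U := line_span rhoX (w, m).
have [U0 UD UZ Ur] : is_submodule rhoX U := line_span_submodule _ _.
have Uw : U (w, m) := line_span_w _ _.
(* The first projection of [U] is a submodule containing w, hence all of V. *)
have Uex v : exists u, U (v, u).
  apply: (irr_full (S := fun v => exists u, U (v, u))) w0 v; last by exists m.
  split.
  - by exists 0.
  - by move=> u v [u' Uu] [v' Uv]; exists (u' + v'); apply: UD Uu Uv.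
  - by move=> a v [v' Uv]; exists (a *: v'); apply: UZ Uv.
  - by move=> i v [v' Uv]; exists (rhoM i v'); apply: Ur Uv.
have Uuniq v u u' : U (v, u) -> U (v, u') -> u = u'.
  move=> Uu Uu'; apply: contrapT => uu'.
  (* The part of [U] over 0 is a submodule; were it nonzero, it would contain a nonzero a (w, m)
     with a w = 0, forcing a = 0. *)
  pose S p := U p /\ p.1 = 0.
  have Ssub : is_submodule rhoX S.
    split.
    - by [].
    - by move=> p q [Up p0] [Uq q0]; split; [apply: UD|rewrite /= p0 q0 addr0].
    - by move=> a p [Up p0]; split; [apply: UZ|rewrite /= p0 scaler0].
    - by move=> i p [Up p0]; split; [apply: Ur|rewrite /= p0 (rho0 gmV)].
  have Sd : S (0, u - u').
    split=> //; have -> : (0, u - u') = (v, u) + (-1) *: (v, u').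
      by apply: injective_projections; rewrite /= scaleN1r ?subrr.
    by apply: UD; last apply: UZ.
  have [|_ [[a ->] [_ /= /eqP]]] := line_span_socle gmX psi_ext XE Ssub Sd.1 Sd.
    by case=> /eqP; rewrite subr_eq0 => /eqP.
  rewrite scaler_eq0 => /orP [/eqP ->|/eqP //]; by rewrite scale0r.
have [f fU] := choice Uex.
exists f; split.
  split; last exact: Uuniq (fU w) Uw.
  split=> [a u v|i v].
    by apply: Uuniq (fU _) _; exact: UD (UZ a _ (fU u)) (fU v).
  by apply: Uuniq (fU _) _; apply: Ur (fU v).
move=> g [[glin gr] gw]; apply: funext.
(* Two module maps agree on a submodule; here it contains w. *)
apply: (irr_full (S := fun v => f v = g v)) w0; last first.
  by rewrite gw; apply: Uuniq (fU w) Uw.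
have g0 : g 0 = 0.
  by have := glin (-1) 0 0; rewrite scaler0 addr0 scaleN1r addNr.
have gD u v : g (u + v) = g u + g v by have := glin 1 u v; rewrite !scale1r.
have gZ a v : g (a *: v) = a *: g v by have := glin a v 0; rewrite !addr0 g0 addr0.
split.
- by rewrite g0; apply: Uuniq (fU 0) U0.
- by move=> u v fu fv; rewrite gD -fu -fv; apply: Uuniq (fU _) _; apply: UD (fU u) (fU v).
- by move=> a v fv; rewrite gZ -fv; apply: Uuniq (fU _) _; apply: UZ (fU v).
- by move=> i v fv; rewrite gr -fv; apply: Uuniq (fU _) _; apply: Ur (fU v).
Qed.

End Line.

(** For k in p, k x v = x k v - [x, k] v, and [x, k] acts by phi([x, k]) = 0. *)
Lemma Vphi_act x v : in_gphi br P phi x -> in_Vphi P rho phi v ->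
  in_Vphi P rho phi (act rho x v).
Proof.
move=> /in_gphiP xg vp; apply/in_VphiP => k Pk.
have vk : rho k v = phi k *: v := (in_VphiP P phi rho v).1 vp k Pk.
have qp : in_p P (fun j => \sum_i x i * br i k j).
  by move=> j nPj; apply: big1 => i _; rewrite idealP ?mulr0.
have := act_rho gmV x k v; rewrite vk (actZ gmV) (vp _ qp) phi_ev_sum xg //.
by rewrite scale0r addr0.
Qed.

Lemma VphiD u v : in_Vphi P rho phi u -> in_Vphi P rho phi v ->
  in_Vphi P rho phi (u + v).
Proof. by move=> up vp x xp; rewrite (actD gmV) up // vp // scalerDr. Qed.

Lemma VphiZ a v : in_Vphi P rho phi v -> in_Vphi P rho phi (a *: v).
Proof. by move=> vp x xp; rewrite (actZ gmV) vp // !scalerA mulrC. Qed.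

Lemma act_comb a b x y v : act rho (fun i => a * x i + b * y i) v
  = a *: act rho x v + b *: act rho y v.
Proof.
rewrite /act !scaler_sumr -big_split; apply: eq_bigr => i _ /=.
by rewrite scalerDl !scalerA.
Qed.

(** That g^phi / p has dimension at most one enters as a coordinate [i0] outside p whose kernel on
    g^phi is p. *)
Variable i0 : I.
Hypothesis nPi0 : ~~ P i0.
Hypothesis gphi_i0 : forall x, in_gphi br P phi x -> x i0 = 0 -> in_p P x.

Definition char_ext (c : C) k := if P k then phi k else if k == i0 then c else 0.

Lemma lin_ev_char_ext c x : lin_ev (char_ext c) x = phi_ev P phi x + c * x i0.
Proof.
have <- := sum_bvec (Q := predT) (fun k => c * x k) (isT : predT i0).
rewrite /phi_ev big_mkcond -big_split; apply: eq_bigr => k _ /=.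
rewrite /char_ext /bvec; case: eqP => [->|_]; last first.
  by rewrite mul0r addr0; case: (P k); rewrite ?mulr0.
by rewrite (negbTE nPi0) mul1r add0r mulrC.
Qed.

(** If y has [i0]-coordinate 0 it lies in p, and x in g^phi gives phi([x, y]) = 0; otherwise a
    combination of x and y lies in p and reduces to that case. *)
Lemma char_ext_extends c : extends_phi br P phi (char_ext c).
Proof.
have extp x : in_p P x -> lin_ev (char_ext c) x = phi_ev P phi x.
  by move=> xp; rewrite lin_ev_char_ext xp // mulr0 addr0.
split=> // x y xg yg.
have [y0|yn0] := eqVneq (y i0) 0.
  have yp := gphi_i0 yg y0.
  by rewrite extp ?xg //; apply: bracket_in_p.
pose z i := y i0 * x i + (- x i0) * y i.
have zp : in_p P z.
  apply: gphi_i0; first exact: in_gphi_comb.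
  by rewrite /z mulNr mulrC subrr.
(* For z = y_0 x - x_0 y, [y, z] = - y_0 [x, y]. The dummy [0 * 0] gives the shape expected by
   [phi_ev_comb]. *)
have -> : bracket br x y = fun k => (- (y i0)^-1) * bracket br y z k + 0 * 0.
  apply: funext => k; rewrite bracket_comb bracketxx bracketC.
  by rewrite !mulr0 !addr0 mulNr mulKf.
rewrite extp.
  by rewrite (phi_ev_comb _ _ _ (fun=> 0)) yg // mulr0 mul0r addr0.
by move=> k nPk; rewrite (bracket_in_p _ zp) // mulr0 mul0r addr0.
Qed.

(** The element x - (x_0 / s_0) s lies in p and acts by phi; thus on V_phi all of g^phi acts through
    s and scalars. *)
Lemma gphi_act s x v : in_gphi br P phi s -> s i0 != 0 ->
  in_gphi br P phi x -> in_Vphi P rho phi v ->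
  act rho x v = (x i0 / s i0) *: act rho s v
    + (phi_ev P phi x - x i0 / s i0 * phi_ev P phi s) *: v.
Proof.
move=> sg s0 xg vp; pose c := x i0 / s i0.
pose p i := 1 * x i + (- c) * s i.
have pp : in_p P p.
  apply: gphi_i0; first exact: in_gphi_comb.
  by rewrite /p /c mulNr divfK // mul1r subrr.
have := vp _ pp; rewrite act_comb phi_ev_comb scale1r mul1r => /eqP.
by rewrite scaleNr subr_eq mulNr addrC => /eqP.
Qed.

Lemma exists_gphi_eigen s w : in_gphi br P phi s -> s i0 != 0 ->
  w <> 0 -> in_Vphi P rho phi w ->
  exists a v, [/\ v <> 0, in_Vphi P rho phi v & act rho s v = a *: v].
Proof.
move=> sg s0 w0 wp; pose sigma := act rho s.
have sD := actD gmV s; have sZ := actZ gmV s.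
have ev_Vphi q v : in_Vphi P rho phi v -> in_Vphi P rho phi (poly_act sigma q v).
  move=> vp; rewrite /poly_act; elim/big_ind: _ => [||i _].
  - by rewrite -(scale0r v); apply: VphiZ.
  - exact: VphiD.
  - by apply: VphiZ; elim: (nat_of_ord i) => //= k IH; apply: Vphi_act.
have [sw0|sw0] := pselect (sigma w = 0).
  by exists 0, w; split; rewrite // scale0r.
pose B v := exists q, v = poly_act sigma q (sigma w).
have B0 : B 0 by exists 0; rewrite /poly_act size_poly0 big_ord0.
have BD u v : B u -> B v -> B (u + v).
  by move=> [q ->] [r ->]; exists (q + r); rewrite poly_actD.
have BZ a v : B v -> B (a *: v).
  by move=> [q ->]; exists (a *: q); rewrite poly_actZ.
have Bphi v : B v -> in_Vphi P rho phi v.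
  by move=> [q ->]; apply/ev_Vphi/Vphi_act.
have Bg x v : in_gphi br P phi x -> B v -> B (act rho x v).
  move=> xg Bv; rewrite (gphi_act sg s0 xg (Bphi _ Bv)).
  apply: (BD _ _ _ (BZ _ _ Bv)); apply: BZ; case: Bv => q ->.
  by exists ('X * q); rewrite (poly_actXM sD sZ).
have Bsw : B (sigma w) by exists 1; rewrite poly_act1.
(* By irreducibility [B] = C[s] s w generates V, so w has some level; being of type phi, it lies in
   [B]. *)
have [d /(filt_prim anti idealP gmV B0 BD BZ Bphi Bg) Bw] :=
  irr_full (span_submodule rho B) (span_B rho Bsw) sw0 w.
have [q wE] := Bw wp.
have [||r [a [r0 rE]]] := @poly_act_eigen _ _ sigma sD sZ (1 - 'X * q) w _ w0.
(* The value of 1 - X q at 0 is 1. *)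
- apply/eqP => /(congr1 (horner^~ 0)) /eqP.
  by rewrite !hornerE subr0 oner_eq0.
- rewrite -scaleN1r poly_actD poly_actZ poly_act1 poly_act_comp -wE.
  by rewrite scaleN1r subrr.
- by exists a, (poly_act sigma r w); split=> //; apply: ev_Vphi.
Qed.

Lemma exists_gphi_character : quasi_whittaker P rho phi ->
  exists w psi, [/\ w <> 0, extends_phi br P phi psi &
    forall x, in_gphi br P phi x -> act rho x w = lin_ev psi x *: w].
Proof.
move=> [w [wp wgen]].
have w0 : w <> 0.
  move=> w0; have [[v v0] _] := irrV; apply: v0.
  apply: (wgen (fun v => v = 0)) => //; split=> //.
  - by move=> _ _ -> ->; rewrite addr0.
  - by move=> a _ ->; rewrite scaler0.
  - by move=> i _ ->; rewrite (rho0 gmV).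
have [[s sg /eqP s0]|h] := pselect (exists2 s, in_gphi br P phi s & s i0 <> 0).
  have [a [v [v0 vp vE]]] := exists_gphi_eigen sg s0 w0 wp.
  (* The constant c solves phi(s) + c s_0 = a, so the extension takes the value a at s. *)
  exists v, (char_ext ((a - phi_ev P phi s) / s i0)); split=> //.
    exact: char_ext_extends.
  move=> x xg; rewrite (gphi_act sg s0 xg vp) vE lin_ev_char_ext.
  rewrite scalerA -scalerDl; congr (_ *: _).
  by rewrite addrCA -mulrBr mulrC mulrCA mulrC.
(* Here g^phi = p, and the quasi-Whittaker generator itself spans the line. *)
exists w, (char_ext 0); split=> //; first exact: char_ext_extends.
move=> x xg; rewrite lin_ev_char_ext mul0r addr0; apply: wp.
by apply: gphi_i0 => //; apply: contrapT => x0; apply: h; exists x.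
Qed.

Lemma irr_quasi_whittaker : quasi_whittaker P rho phi ->
  bland P rho phi /\ exists psi, extends_phi br P phi psi /\
    iso_induced br rho (in_gphi br P phi) (lin_ev psi).
Proof.
move=> /exists_gphi_character [w [psi [w0 ext wE]]].
split; first exact: (bland_line w0 ext wE).
by exists psi; split=> //; apply: iso_induced_line w0 ext wE.
Qed.

End Irreducible.
End Character.

(** * Coordinates on sl_2 and the equations of the stabiliser *)

Notation e3 := (@Ordinal 3 0 isT).
Notation h3 := (@Ordinal 3 1 isT).
Notation f3 := (@Ordinal 3 2 isT).

Lemma ord3P (Q : 'I_3 -> Prop) : Q e3 -> Q h3 -> Q f3 -> forall a, Q a.
Proof.
move=> Q0 Q1 Q2 [[|[|[|//]]] lt_a];
  by rewrite (bool_irrelevance lt_a isT).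
Qed.

Lemma sum3 (W : nmodType) (F : 'I_3 -> W) : \sum_a F a = F e3 + (F h3 + F f3).
Proof.
rewrite !big_ord_recl big_ord0 addr0; congr (F _ + (F _ + F _));
  exact/val_inj.
Qed.

Lemma sl2_br_anti a b c : sl2_br a b c = - sl2_br b a c.
Proof.
by elim/ord3P: a; elim/ord3P: b; elim/ord3P: c; rewrite /sl2_br /= ?oppr0 ?opprK.
Qed.

Section Stabilizer.
Variables (I : finType) (br : I -> I -> I -> C) (P : pred I) (phi : I -> C).
Hypothesis phi_hom : is_lie_hom_p br P phi.

(** Here [s] identifies the basis of sl_2 with the basis vectors outside p. The coordinates of x in
    p drop out because phi kills [p, p]. *)
Lemma in_gphi_sl2 (s : 'I_3 -> I) (t : I -> 'I_3) x j :
  (forall a, ~~ P (s a)) -> cancel s t -> (forall i, ~~ P i -> s (t i) = i) ->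
  in_gphi br P phi x -> P j ->
  x (s e3) * phi_ev P phi (br (s e3) j) + (x (s h3) * phi_ev P phi (br (s h3) j)
   + x (s f3) * phi_ev P phi (br (s f3) j)) = 0.
Proof.
move=> nPs sK tK /in_gphiP xg Pj.
rewrite -(sum3 (fun a => x (s a) * phi_ev P phi (br (s a) j))) -[RHS](xg j Pj).
transitivity (\sum_(i | ~~ P i) x i * phi_ev P phi (br i j)).
  rewrite [RHS](reindex s); last first.
    by exists t => [a _|i]; [apply: sK|rewrite inE; apply: tK].
  by apply: eq_bigl => a; rewrite nPs.
rewrite big_mkcond; apply: eq_bigr => i _.
have [Pi|//] := boolP (P i).
have /in_gphiP /(_ j Pj) := in_p_gphi phi_hom (in_p_bvec Pi).
by rewrite (sum_bvec (fun i => phi_ev P phi (br i j))) // => ->; rewrite mulr0.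
Qed.

End Stabilizer.

(* The coordinate singled out is dual to the stabiliser line: f, h or e
   according to whether the lowest nonzero entry of p is the first, an
   intermediate or the last one. *)
Lemma gal_stabilizer (F : numFieldType) m (p : nat -> F) :
  (0 < m)%N -> (exists k, p k != 0) -> (forall k, (m < k)%N -> p k = 0) ->
  exists a0 : 'I_3, forall X : 'I_3 -> F,
    (forall k, (k <= m)%N -> X e3 * (k%:R * p k.-1)
       + (X h3 * ((m%:Z - (2 * k)%:Z)%:~R * p k) + X f3 * ((m - k)%:R * p k.+1)) = 0) ->
    X a0 = 0 -> forall a, X a = 0.
Proof.
move=> m0 pex pbig; have [K pK Kmin] := ex_minnP pex.
have Km : (K <= m)%N by rewrite leqNgt; apply: contraNN pK => /pbig ->.
have plow k : (k < K)%N -> p k = 0.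
  by move=> kK; apply/eqP; apply: contraTT kK => /Kmin; rewrite -leqNgt.
have [K0|K0] := posnP K.
  (* Equation k = 0 reads m X_h p_0 = 0, and then equation k = 1 reads X_e p_0 = 0. *)
  exists f3 => X XE Xf; have := XE 0%N isT; have := XE 1%N m0.
  rewrite Xf; rewrite K0 in pK.
  rewrite !(mul0r, mulr0, add0r, addr0) mul1r => He /eqP.
  rewrite !mulf_eq0 (negbTE pK) orbF intr_eq0 eqz_nat (gtn_eqF m0) orbF => /eqP Xh.
  move: He; rewrite Xh mul0r addr0 => /eqP.
  by rewrite mulf_eq0 (negbTE pK) orbF => /eqP Xe; elim/ord3P.
have Xf0 X : (forall k, (k <= m)%N -> X e3 * (k%:R * p k.-1)
       + (X h3 * ((m%:Z - (2 * k)%:Z)%:~R * p k) + X f3 * ((m - k)%:R * p k.+1)) = 0) ->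
     X f3 = 0.
  (* In equation k = K - 1 only (m - K + 1) X_f p_K survives. *)
  move=> XE; have := XE K.-1 (leq_trans (leq_pred _) Km).
  rewrite prednK // (plow K.-1) ?prednK // !mulr0 add0r.
  rewrite (_ : K.-1%:R * p K.-1.-1 = 0) ?mulr0 ?add0r; last first.
    (* For K = 1 the index K - 2 is truncated to 0, but its coefficient K - 1 vanishes. *)
    case: (K) K0 plow => // -[|k] _ plw /=; first by rewrite mul0r.
    by rewrite plw ?mulr0.
  move=> /eqP; rewrite !mulf_eq0 (negbTE pK) orbF pnatr_eq0 subn_eq0 => /orP [/eqP //|].
  by move=> /(leq_trans Km); rewrite leqNgt ltn_predL K0.
have [Kltm|mK] := ltnP K m.
  (* Equation k = K + 1 leaves (K + 1) X_e p_K = 0. *)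
  exists h3 => X XE Xh; have Xf := Xf0 X XE; have := XE K.+1 Kltm.
  rewrite Xh Xf !mul0r !addr0 => /eqP.
  by rewrite !mulf_eq0 (negbTE pK) orbF pnatr_eq0 orbF => /eqP Xe; elim/ord3P.
have {mK Km} mE : K = m by apply/eqP; rewrite eqn_leq Km.
(* Equation k = m leaves - m X_h p_m = 0. *)
exists e3 => X XE Xe; have Xf := Xf0 X XE; have := XE K; rewrite {1}mE => /(_ (leqnn m)).
rewrite Xe Xf !mul0r addr0 add0r => /eqP.
rewrite !mulf_eq0 (negbTE pK) orbF intr_eq0 mE subr_eq0 eqz_nat.
by rewrite (ltn_eqF (ltn_Pmull (isT : 1 < 2)%N m0)) orbF => /eqP Xh; elim/ord3P.
Qed.

(** * The conformal Galilei algebras *)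

Section Galilei.
Variables (m : nat) (phi : galI m -> C).

Lemma gal_anti (i j k : galI m) : gal_br i j k = - gal_br j i k.
Proof.
by case: i j k => [a|i] [b|j] [c|k] //=; rewrite ?oppr0 ?opprK //; apply: sl2_br_anti.
Qed.

Lemma gal_ideal (i j k : galI m) : gal_p m j -> ~~ gal_p m k -> gal_br i j k = 0.
Proof. by case: i j k => [a|i] [b|j] [c|k]. Qed.

(** [phi] on the p_k, extended by zero to all natural indices so that the neighbours k - 1 and k + 1
    need no bounds. *)
Definition gal_seq (i : nat) : C :=
  \sum_(j < m.+1) (if (j == i :> nat) then 1 else 0) * phi (inr j).

Lemma gal_seqE (j : 'I_m.+1) : gal_seq j = phi (inr j).
Proof.
rewrite -(sum_delta (fun k => phi (inr k)) (Q := predT) (i := j)) //.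
by apply: eq_bigr => k _; rewrite -val_eqE; case: eqP.
Qed.

Lemma gal_phi_ev a k : phi_ev (gal_p m) phi (gal_br (inl a) (inr k)) =
  \sum_(j < m.+1) galp a k j * phi (inr j).
Proof.
rewrite /phi_ev (reindex (inr : 'I_m.+1 -> galI m)) //.
exists (fun z => if z is inr j then j else ord0) => [//|[]//].
Qed.

Lemma gal_phi_ev_e k : phi_ev (gal_p m) phi (gal_br (inl e3) (inr k)) =
  k%:R * gal_seq k.-1.
Proof.
rewrite gal_phi_ev mulr_sumr; apply: eq_bigr => j _; rewrite mulrA /galp /=.
case: (k : nat) => [|k'] /=; first by rewrite !mul0r.
by rewrite eqSS; case: eqP; rewrite ?mulr1 ?mulr0.
Qed.

Lemma gal_phi_ev_h k : phi_ev (gal_p m) phi (gal_br (inl h3) (inr k)) =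
  (m%:Z - (2 * k)%:Z)%:~R * gal_seq k.
Proof.
rewrite gal_phi_ev mulr_sumr; apply: eq_bigr => j _; rewrite mulrA /galp /=.
by rewrite -val_eqE /=; case: eqP; rewrite ?mulr1 ?mulr0.
Qed.

Lemma gal_phi_ev_f k : phi_ev (gal_p m) phi (gal_br (inl f3) (inr k)) =
  (m - k)%:R * gal_seq k.+1.
Proof.
rewrite gal_phi_ev mulr_sumr; apply: eq_bigr => j _; rewrite mulrA /galp /=.
by case: eqP; rewrite ?mulr1 ?mulr0.
Qed.

Lemma gal_gphi_coord : (0 < m)%N -> is_lie_hom_p (@gal_br m) (gal_p m) phi ->
  nonzero_p (gal_p m) phi ->
  exists2 i0, ~~ gal_p m i0 & forall x, in_gphi (@gal_br m) (gal_p m) phi x ->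
    x i0 = 0 -> in_p (gal_p m) x.
Proof.
move=> m0 hom [] [a|k0] [] // _ /eqP nz.
have [||a0 a0P] := gal_stabilizer (p := gal_seq) m0.
- by exists k0; rewrite gal_seqE.
- move=> k mk; rewrite /gal_seq; apply: big1 => j _.
  by rewrite (ltn_eqF (leq_trans (ltn_ord j) mk)) mul0r.
exists (inl a0) => // x xg x0 [a _|//].
apply: (a0P (fun a => x (inl a))) => // k km.
pose t (z : galI m) := if z is inl a then a else e3.
have := @in_gphi_sl2 _ _ _ _ hom inl t x (inr (Ordinal (km : (k < m.+1)%N))).
rewrite gal_phi_ev_e gal_phi_ev_h gal_phi_ev_f; apply=> //.
by case.
Qed.

End Galilei.

(** * The Schroedinger algebras *)

Section Schroedinger.
Variables (n : nat) (phi : schI n -> C).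

Definition sch_s (a : 'I_3) : schI n := inl (inl (inl a)).
Definition sch_x (i : 'I_n) : schI n := inl (inl (inr i)).
Definition sch_y (i : 'I_n) : schI n := inl (inr i).
Definition sch_z : schI n := inr tt.

Lemma sch_anti (i j k : schI n) : sch_br i j k = - sch_br j i k.
Proof.
case: i j k => [[[a|i]|i]|[]] [[[b|j]|j]|[]] [[[c|k]|k]|[]] //=;
  rewrite ?oppr0 ?opprK //; exact: sl2_br_anti.
Qed.

Lemma sch_ideal (i j k : schI n) : sch_p n j -> ~~ sch_p n k -> sch_br i j k = 0.
Proof. by case: i j k => [[[a|i]|i]|[]] [[[b|j]|j]|[]] [[[c|k]|k]|[]]. Qed.

Lemma sch_phi_ev_bvec2 a b i j : sch_p n i -> sch_p n j ->
  phi_ev (sch_p n) phi (fun k => a * bvec i k + b * bvec j k) = a * phi i + b * phi j.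
Proof. by move=> Pi Pj; rewrite phi_ev_comb /phi_ev !(sum_bvec phi). Qed.

Lemma sch_phi_ev_x a i : phi_ev (sch_p n) phi (sch_br (sch_s a) (sch_x i)) =
  sl2V a false false * phi (sch_x i) + sl2V a false true * phi (sch_y i).
Proof.
rewrite -sch_phi_ev_bvec2 //; congr phi_ev; apply: funext.
rewrite /bvec => -[[[c|k]|k]|[]] /=; rewrite ?mulr0 ?addr0 //.
  by rewrite mulrC eq_sym.
by rewrite add0r mulrC eq_sym.
Qed.

Lemma sch_phi_ev_y a i : phi_ev (sch_p n) phi (sch_br (sch_s a) (sch_y i)) =
  sl2V a true false * phi (sch_x i) + sl2V a true true * phi (sch_y i).
Proof.
rewrite -sch_phi_ev_bvec2 //; congr phi_ev; apply: funext.
rewrite /bvec => -[[[c|k]|k]|[]] /=; rewrite ?mulr0 ?addr0 //.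
  by rewrite mulrC eq_sym.
by rewrite add0r mulrC eq_sym.
Qed.

(** z = [x_i, y_i] is a bracket of elements of p, and n > 0 supplies an index i. *)
Lemma sch_phi_z : (0 < n)%N -> is_lie_hom_p (@sch_br n) (sch_p n) phi ->
  phi sch_z = 0.
Proof.
move=> n0 hom; pose i0 := Ordinal n0.
have xp : sch_p n (sch_x i0) by [].
have /in_gphiP /(_ (sch_y i0) isT) := in_p_gphi hom (in_p_bvec xp).
rewrite (sum_bvec (fun i => phi_ev _ _ (sch_br i _))) // => <-.
rewrite -(sum_bvec (Q := sch_p n) phi (i := sch_z)) //.
apply: eq_bigr => -[[[c|k]|k]|[]] _; rewrite /bvec /= ?eqxx ?mul0r //.
Qed.

(** As phi(z) = 0, phi is nonzero on some x_i or y_i. With alpha = phi(x_i) and beta = phi(y_i),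
    pairing with x_i and y_i gives h alpha + f beta = 0 and e alpha - h beta = 0 for the sl_2
    coordinates, a system of rank two. *)
Lemma sch_gphi_coord : (0 < n)%N -> is_lie_hom_p (@sch_br n) (sch_p n) phi ->
  nonzero_p (sch_p n) phi ->
  exists2 i0, ~~ sch_p n i0 & forall x, in_gphi (@sch_br n) (sch_p n) phi x ->
    x i0 = 0 -> in_p (sch_p n) x.
Proof.
move=> n0 hom nz.
have {nz} [i nz] : exists i, phi (sch_x i) != 0 \/ phi (sch_y i) != 0.
  case: nz => -[[[a|i]|i]|[]] [] // _ /eqP nz.
  - by exists i; left.
  - by exists i; right.
  - by move: nz; rewrite sch_phi_z ?eqxx.
pose t (u : schI n) := if u is inl (inl (inl a)) then a else e3.
have eqx x (xg : in_gphi (@sch_br n) (sch_p n) phi x) :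
    x (sch_s h3) * phi (sch_x i) + x (sch_s f3) * phi (sch_y i) = 0.
  have := @in_gphi_sl2 _ _ _ _ hom sch_s t x (sch_x i).
  rewrite !sch_phi_ev_x /sl2V /= !mul0r !mul1r !addr0 !add0r mulr0 add0r.
  by apply=> // -[[[]|]|].
have eqy x (xg : in_gphi (@sch_br n) (sch_p n) phi x) :
    x (sch_s e3) * phi (sch_x i) - x (sch_s h3) * phi (sch_y i) = 0.
  have := @in_gphi_sl2 _ _ _ _ hom sch_s t x (sch_y i).
  rewrite !sch_phi_ev_y /sl2V /= !mul0r !mul1r !addr0 !add0r mulr0 addr0 mulN1r mulrN.
  by apply=> // -[[[]|]|].
have full x : x (sch_s e3) = 0 -> x (sch_s h3) = 0 -> x (sch_s f3) = 0 ->
    in_p (sch_p n) x.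
  by move=> xe xh xf [[[a|//]|//]|//] _; elim/ord3P: a.
(* For alpha = 0 the free coordinate is e; otherwise it is f, which determines h and then e. *)
have [x0|xn0] := eqVneq (phi (sch_x i)) 0.
  have yn0 : phi (sch_y i) != 0 by case: nz => //; rewrite x0 eqxx.
  exists (sch_s e3) => // x xg xe; apply: full => //.
    have /eqP := eqy _ xg; rewrite xe mul0r sub0r oppr_eq0 mulf_eq0 (negbTE yn0).
    by rewrite orbF => /eqP.
  have /eqP := eqx _ xg; rewrite x0 mulr0 add0r mulf_eq0 (negbTE yn0).
  by rewrite orbF => /eqP.
exists (sch_s f3) => // x xg xf.
have xh : x (sch_s h3) = 0.
  have /eqP := eqx _ xg; rewrite xf mul0r addr0 mulf_eq0 (negbTE xn0).
  by rewrite orbF => /eqP.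
apply: full => //; have /eqP := eqy _ xg.
by rewrite xh mul0r subr0 mulf_eq0 (negbTE xn0) orbF => /eqP.
Qed.

End Schroedinger.

Theorem theorem4p1 :
  (* (a) conformal Galilei algebra g^(l), m = 2l, l in (1/2)N, l > 0 *)
  (forall (m : nat), (0 < m)%N ->
   forall phi : galI m -> C,
     is_lie_hom_p (@gal_br m) (gal_p m) phi -> nonzero_p (gal_p m) phi ->
   forall (V : lmodType C) (rho : galI m -> V -> V),
     is_gmodule (@gal_br m) rho -> irreducible rho ->
     quasi_whittaker (gal_p m) rho phi ->
     bland (gal_p m) rho phi /\
     (iso_induced (@gal_br m) rho (in_p (gal_p m)) (phi_ev (gal_p m) phi) \/
      exists psi : galI m -> C,
        extends_phi (@gal_br m) (gal_p m) phi psi /\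
        iso_induced (@gal_br m) rho (in_gphi (@gal_br m) (gal_p m) phi) (lin_ev psi)))
  /\
  (* (b) Schroedinger algebra sch_n, n >= 1 *)
  (forall (n : nat), (0 < n)%N ->
   forall phi : schI n -> C,
     is_lie_hom_p (@sch_br n) (sch_p n) phi -> nonzero_p (sch_p n) phi ->
   forall (V : lmodType C) (rho : schI n -> V -> V),
     is_gmodule (@sch_br n) rho -> irreducible rho ->
     quasi_whittaker (sch_p n) rho phi ->
     bland (sch_p n) rho phi /\
     (iso_induced (@sch_br n) rho (in_p (sch_p n)) (phi_ev (sch_p n) phi) \/
      exists psi : schI n -> C,
        extends_phi (@sch_br n) (sch_p n) phi psi /\
        iso_induced (@sch_br n) rho (in_gphi (@sch_br n) (sch_p n) phi) (lin_ev psi))).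
Proof.
split=> [m m0|n n0] phi hom nz V rho gmV irrV qw.
  have [i0 nPi0 i0P] := gal_gphi_coord m0 hom nz.
  have [] := irr_quasi_whittaker (@gal_anti m) (@gal_ideal m) hom gmV irrV nPi0 i0P qw.
  by split; last right.
have [i0 nPi0 i0P] := sch_gphi_coord n0 hom nz.
have [] := irr_quasi_whittaker (@sch_anti n) (@sch_ideal n) hom gmV irrV nPi0 i0P qw.
by split; last right.
Qed.
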